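(* Let $X$ be a uniformly convex Banach space, let $A_1,\dots,A_m$ be nonempty subsets of $X$, let $1\le p\le\infty$, let $\varphi:[0,\infty)\to[0,\infty)$ be strictly increasing, and let $T:\bigcup_{i=1}^m A_i\to\bigcup_{i=1}^m A_i$ be a cyclic $p$-$\varphi$-contraction. Let $x_0\in A_1$ and $x_n=Tx_{n-1}$ for $n\ge1$. Let $i_0\in\{1,\dots,m\}$ be such that $A_{i_0}$ is a closed convex subset of $X$ and $d(A_{i_0},A_{i_0+1})=d_\infty(A_1,\dots,A_m)$. Then there exists a unique $x\in A_{i_0}$ such that $x_{mn+i_0-1}\to x$ as $n\to\infty$, $T^m x=x$, and $$d_p(x,Tx,\dots,T^{m-1}x)=d_p(A_1,A_2,\dots,A_m).$$
   Context: Here $m$ is a positive integer, indices of the sets are cyclic ($A_{m+1}=A_1$), $d(x,y)=\|x-y\|$, and $d(A,B)=\inf\{d(a,b):a\in A,b\in B\}$. For $1\le p<\infty$, $d_p(A_1,\dots,A_m)=\left(\sum_{i=1}^m d(A_i,A_{i+1})^p\right)^{1/p}$, and $d_\infty(A_1,\dots,A_m)=\max_{1\le i\le m} d(A_i,A_{i+1})$. For points $x_1,\dots,x_m,y_1,\dots,y_m\in X$ with $y_{m+1}=y_1$, $d_p(x_1,\dots,x_m;y_1,\dots,y_m)=\left(\sum_{i=1}^m d(x_i,y_{i+1})^p\right)^{1/p}$ for $1\le p<\infty$, and $d_\infty(x_1,\dots,x_m;y_1,\dots,y_m)=\max_{1\le i\le m} d(x_i,y_{i+1})$. Also $d_p(x_1,\dots,x_m)=d_p(x_1,\dots,x_m;x_1,\dots,x_m)$.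 A map $T:\bigcup_i A_i\to\bigcup_i A_i$ is a cyclic $p$-$\varphi$-contraction if $T(A_i)\subset A_{i+1}$ for $i=1,\dots,m$ and, for all $x_i,y_i\in A_i$ ($i=1,\dots,m$), $$d_p(Tx_1,\dots,Tx_m;Ty_1,\dots,Ty_m)\le d_p(x_1,\dots,x_m;y_1,\dots,y_m)-\varphi\big(d_p(x_1,\dots,x_m;y_1,\dots,y_m)\big)+\varphi\big(d_p(A_1,\dots,A_m)\big).$$ A Banach space $X$ is uniformly convex if there is a strictly increasing function $\delta:(0,2]\to[0,1]$ such that for all $x,y,w\in X$, $R>0$ and $r\in[0,2R]$: if $\|x-w\|\le R$, $\|y-w\|\le R$ and $\|x-y\|\ge r$, then $\left\|\frac{x+y}{2}-w\right\|\le\left(1-\delta(r/R)\right)R$ (understood for $r>0$, where $\delta(r/R)$ is defined). *)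

(* Defs.v *)
From HB Require Import structures.
From mathcomp Require Import all_boot all_order all_algebra.
From mathcomp Require Import all_classical all_reals all_analysis.
Import Order.TTheory GRing.Theory Num.Theory.
Import numFieldNormedType.Exports.

Set Implicit Arguments.
Unset Strict Implicit.
Unset Printing Implicit Defensive.

Local Open Scope classical_set_scope.
Local Open Scope ring_scope.

(* Families of sets and points are indexed by 'I_m, so the index i stands for
   i + 1 in the usual 1-based numbering; ordS is the cyclic successor. *)

Definition dist_sets {R : realType} {X : normedModType R} (A B : set X) : R :=
  inf [set `|a - b| | a in A & b in B].

(* The -oo branch is junk: p is meant to range over [1, +oo]. Starting the
   maximum at 0 is harmless since c is only used with nonnegative values. *)
Definition lp_comb {R : realType} (p : \bar R) (m : nat) (c : 'I_m -> R) : R :=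
  match p with
  | r%:E => (\sum_(i < m) c i `^ r) `^ r^-1
  | +oo%E => \big[Num.max/0]_(i < m) c i
  | -oo%E => 0
  end.

Definition dp_sets {R : realType} {X : normedModType R} (p : \bar R) (m : nat)
    (A : 'I_m -> set X) : R :=
  lp_comb p (fun i => dist_sets (A i) (A (ordS i))).

Definition dp_points {R : realType} {X : normedModType R} (p : \bar R)
    (m : nat) (x y : 'I_m -> X) : R :=
  lp_comb p (fun i => `|x i - y (ordS i)|).

(* T is a total function on X; only its values on the union of the A i matter. *)
Definition cyclic_p_phi_contraction {R : realType} {X : normedModType R}
    (p : \bar R) (phi : R -> R) (m : nat) (A : 'I_m -> set X) (T : X -> X) :
    Prop :=
  (forall i, T @` A i `<=` A (ordS i)) /\
  (forall x y : 'I_m -> X, (forall i, A i (x i)) -> (forall i, A i (y i)) ->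
     dp_points p (T \o x) (T \o y)
       <= dp_points p x y - phi (dp_points p x y) + phi (dp_sets p A)).

Definition uniformly_convex {R : realType} (X : normedModType R) : Prop :=
  exists delta : R -> R,
    [/\ {in `]0, 2], forall t, 0 <= delta t <= 1},
        {in `]0, 2] &, {homo delta : s t / s < t}} &
        forall (x y w : X) (K r : R), 0 < K -> 0 < r <= 2 * K ->
          `|x - w| <= K -> `|y - w| <= K -> r <= `|x - y| ->
          `|2^-1 *: (x + y) - w| <= (1 - delta (r / K)) * K].

(* Main.v *)
(* Write d_p(x; y) for the cyclic distance of two families with x_i, y_i in A_i,
   D for d_p(A_1, ..., A_m), and u(v) for the family v, Tv, ..., T^(m-1) v read
   from position i0, where v lies in A_i0. Since phi is strictly increasing, T
   does not increase d_p, and d_p of the iterates of any two families tends to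
   D. The i0-th distance is then forced to d(A_i0, A_(i0+1)) (when p = oo this
   uses that it is the largest one), so uniform convexity gives
   w_(k+1) - w_k -> 0 for w_k = T^(mk + i0) x_0.

   Applying T to u(v) changes it only at position i0, where v becomes T^m v.
   Hence the contraction inequality for the pair u(v), u(v') reads
     phi(d_p(u(v); u(v'))) - phi(D) <= |v - T^m v| + |v' - T^m v'|.
   With v = w_k and v' = w_l this gives d_p(u(w_k); u(w_l)) -> D as k, l -> oo,
   without any bound on the orbit, and uniform convexity makes (w_k) Cauchy.
   Let x be its limit. T need not be continuous, but replacing w_k by x at
   position i0 of u(w_k) and applying T m times shows that T^m x is close to
   w_(k+1), so T^m x = x. The displayed inequality with v = v' = x then yields
   d_p(u(x); u(x)) = D. *)

Require Import Defs.
From HB Require Import structures.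
From mathcomp Require Import all_boot all_order all_algebra.
From mathcomp Require Import all_classical all_reals all_analysis.
From mathcomp Require Import ring lra.
Import Order.TTheory GRing.Theory Num.Theory.
Import numFieldNormedType.Exports.

Set Implicit Arguments.
Unset Strict Implicit.
Unset Printing Implicit Defensive.

Local Open Scope classical_set_scope.
Local Open Scope ring_scope.

(** * Monotonicity and perturbation of the l^p combination *)

Lemma lp_comb_le (R : realType) (p : \bar R) (m : nat) (c c' : 'I_m -> R) :
  (1 <= p)%E -> (forall i, 0 <= c i <= c' i) -> lp_comb p c <= lp_comb p c'.
Proof.
case: p => [r| |] r1 cc' /=; last by [].
- have r0 : 0 <= r by rewrite lee_fin in r1; apply: le_trans r1.
  have sum0 b : 0 <= \sum_(i < m) b i `^ r.
    by rewrite sumr_ge0// => i _; exact: powR_ge0.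
  rewrite ge0_ler_powR ?nnegrE ?invr_ge0//.
  apply: ler_sum => i _; have /andP[ci0 cc'i] := cc' i.
  by rewrite ge0_ler_powR ?nnegrE// (le_trans ci0).
- apply/bigmax_leP; split => [|i _]; first exact: bigmax_ge_id.
  by have /andP[_ /le_trans] := cc' i; apply; apply: le_bigmax.
Qed.

Lemma lp_comb_reindex (R : realType) (p : \bar R) (m : nat) (c : 'I_m -> R)
    (h : 'I_m -> 'I_m) :
  injective h -> lp_comb p (c \o h) = lp_comb p c.
Proof.
case: p => [r| |] hinj; rewrite /lp_comb.
- congr (_ `^ _); exact/esym/(reindex_inj hinj).
- exact/esym/(reindex_inj hinj).
- by [].
Qed.

Lemma lp_comb_ge0 (R : realType) (p : \bar R) (m : nat) (c : 'I_m -> R) :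
  0 <= lp_comb p c.
Proof.
by case: p => [r| |]; rewrite /lp_comb; [exact: powR_ge0|exact: bigmax_ge_id|].
Qed.

Lemma powR_lp_comb (R : realType) (r : R) (m : nat) (c : 'I_m -> R) :
  1 <= r -> lp_comb r%:E c `^ r = \sum_(i < m) c i `^ r.
Proof.
move=> r1; rewrite /= -powRrM mulVf ?gt_eqF// ?(lt_le_trans _ r1)// powRr1//.
by rewrite sumr_ge0// => i _; rewrite powR_ge0.
Qed.

Lemma powR_convex (R : realType) (r t a b : R) : 1 <= r -> 0 <= t <= 1 ->
  0 <= a -> 0 <= b ->
  ((1 - t) * a + t * b) `^ r <= (1 - t) * a `^ r + t * b `^ r.
Proof.
move=> r1 /andP[t0 t1] a0 b0.
rewrite addrC [leRHS]addrC.
by apply: (convex_powR r1 (Itv01 t0 t1)); rewrite inE/= in_itv/= andbT.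
Qed.

(** Minkowski's inequality for a perturbation supported at the single index [i]; for finite
    exponents it follows from convexity of the power function. *)
Lemma lp_comb_perturb (R : realType) (p : \bar R) (m : nat) (c c' : 'I_m -> R)
    (i : 'I_m) (e : R) : (1 <= p)%E -> 0 <= e ->
  (forall j, 0 <= c j) -> (forall j, 0 <= c' j) ->
  (forall j, j != i -> c j = c' j) -> c i <= c' i + e ->
  lp_comb p c <= lp_comb p c' + e.
Proof.
case: p => [r| |] r1 e0 c0 c'0 cc' ci; last by []; last first.
  apply/bigmax_leP; split => [|j _].
    by rewrite addr_ge0// bigmax_ge_id.
  have [->|ji] := eqVneq j i.
    by rewrite (le_trans ci)// lerD2r le_bigmax.
  by rewrite cc'// (le_trans (le_bigmax 0 c' j))// lerDl.
rewrite lee_fin in r1.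
set N := lp_comb r%:E c'.
have N0 : 0 <= N by exact: lp_comb_ge0.
have r0 : 0 < r by apply: lt_le_trans r1.
have := e0; rewrite le_eqVlt => /orP[/eqP e_eq|e_gt0].
  rewrite -e_eq addr0; apply: lp_comb_le => // j; rewrite c0/=.
  have [->|ji] := eqVneq j i; last by rewrite cc'.
  by move: ci; rewrite -e_eq addr0.
have Ne : 0 < N + e by lra.
suff : lp_comb r%:E c `^ r <= (N + e) `^ r.
  have : 0 <= lp_comb r%:E c by exact: lp_comb_ge0.
  move: (lp_comb r%:E c) => M M0; apply: contraTT; rewrite -!ltNge => NeM.
  by apply: gt0_ltr_powR; rewrite ?nnegrE// ltW.
(* With t = e / (N + e), each c j is at most (N + e) times the convex combination
   (1 - t) * (c' j / N) + t * (j == i), and x `^ r is convex. *)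
rewrite powR_lp_comb//.
have [t t01 e_t] : exists2 t, 0 <= t <= 1 & e = t * (N + e).
  exists (e / (N + e)); last by rewrite divfK ?gt_eqF.
  by rewrite divr_ge0 ?(ltW Ne)//= ler_pdivrMr// mul1r lerDr.
have N_t : N = (1 - t) * (N + e) by rewrite mulrBl mul1r -e_t addrK.
have /andP[t0 _] := t01.
have t1 : 0 <= 1 - t by lra.
(* For [N = 0] the quotients [c' j / N] carry no information, but then every [c' j] vanishes and
   only the [i]-th summand survives. *)
have [N_eq|N_neq] := eqVneq N 0.
  have c'_eq j : c' j = 0.
    have : \sum_(i < m) c' i `^ r = 0.
      by rewrite -powR_lp_comb// -/N N_eq powR0// gt_eqF.
    move/eqP; rewrite psumr_eq0 => [/allP/(_ j)|k _]; last exact: powR_ge0.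
    by rewrite mem_index_enum => /(_ isT)/= /[!powR_eq0] /andP[/eqP].
  rewrite (bigD1 i)//= big1 ?addr0 => [|j ji].
    rewrite ge0_ler_powR ?nnegrE ?(ltW r0) ?(ltW Ne)//.
    by rewrite N_eq add0r (le_trans ci)// c'_eq add0r.
  by rewrite cc'// c'_eq powR0// gt_eqF.
have N_gt0 : 0 < N by rewrite lt_def N_neq.
have bnd j : c j `^ r <=
    (N + e) `^ r * ((1 - t) * (c' j / N) `^ r + t * (j == i)%:R).
  have cj : c j <= (N + e) * ((1 - t) * (c' j / N) + t * (j == i)%:R).
    have -> : (N + e) * ((1 - t) * (c' j / N) + t * (j == i)%:R) =
        c' j + e * (j == i)%:R.
      rewrite mulrDr [_ * ((1 - t) * _)]mulrA [_ * (1 - t)]mulrC -N_t.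
      by rewrite [_ * (t * _)]mulrA [_ * t]mulrC -e_t mulrCA divff// mulr1.
    have [->|ji] := eqVneq j i; first by rewrite mulr1.
    by rewrite mulr0 addr0 cc'.
  have b0 : 0 <= (1 - t) * (c' j / N) + t * (j == i)%:R.
    by rewrite addr_ge0 ?mulr_ge0 ?invr_ge0.
  apply: (@le_trans _ _ (((N + e) * ((1 - t) * (c' j / N) + t * (j == i)%:R)) `^ r)).
    by rewrite ge0_ler_powR ?nnegrE ?(ltW r0)// mulr_ge0 ?(ltW Ne).
  rewrite powRM ?(ltW Ne)// ler_wpM2l ?powR_ge0//.
  apply: le_trans (powR_convex r1 t01 _ _) _ => //.
    by rewrite mulr_ge0// invr_ge0.
  rewrite lerD2l; case: eqP => _; first by rewrite powR1.
  by rewrite powR0// gt_eqF.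
apply: le_trans (ler_sum _ (fun j _ => bnd j)) _.
rewrite -mulr_sumr ler_piMr ?powR_ge0// big_split/= -!mulr_sumr.
have -> : \sum_(j < m) (c' j / N) `^ r = 1.
  under eq_bigr do rewrite powRM ?invr_ge0//.
  rewrite -mulr_suml -powR_lp_comb// -/N -powRM ?invr_ge0// divff//.
  by rewrite powR1.
rewrite (bigD1 i)//= eqxx big1 => [|j /negPf->//].
by rewrite addr0 !mulr1 subrK.
Qed.

(** For finite [p] the [i]-th summand grows strictly; for [p = +oo] the maximum itself grows because
    [d i] attains it. *)
Lemma lp_comb_lt (R : realType) (p : \bar R) (m : nat) (d : 'I_m -> R)
    (i : 'I_m) (e : R) : (1 <= p)%E -> (forall j, 0 <= d j) ->
  d i = lp_comb +oo%E d -> 0 < e ->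
  lp_comb p d < lp_comb p (fun j => d j + e *+ (j == i)).
Proof.
case: p => [r| |] r1 d0 di e0; last by []; last first.
  apply: (@lt_le_trans _ _ (d i + e)); first by rewrite di ltrDl.
  have := le_bigmax 0 (fun j => d j + e *+ (j == i)) i.
  by rewrite eqxx.
rewrite lee_fin in r1; have r0 : 0 < r by apply: lt_le_trans r1.
have de0 j : 0 <= d j + e *+ (j == i) by rewrite addr_ge0// mulrn_wge0// ltW.
rewrite /= gt0_ltr_powR ?invr_gt0 ?nnegrE//.
- by rewrite sumr_ge0// => j _; exact: powR_ge0.
- by rewrite sumr_ge0// => j _; exact: powR_ge0.
rewrite (bigD1 i)//= [ltRHS](bigD1 i)//= eqxx mulr1n ltr_leD//.
  by rewrite gt0_ltr_powR ?nnegrE ?addr_ge0 ?(ltW e0)// ltrDl.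
by apply: ler_sum => j /negPf->; rewrite addr0.
Qed.

(** * Distances between sets and uniform convexity *)

Lemma dist_sets_le (R : realType) (X : normedModType R) (A B : set X) (a b : X) :
  A a -> B b -> dist_sets A B <= `|a - b|.
Proof.
move=> Aa Bb; apply: ge_inf; last by exists a => //; exists b.
by exists 0 => _ [x _ [y _ <-]].
Qed.

Lemma dist_sets_ge0 (R : realType) (X : normedModType R) (A B : set X) :
  A !=set0 -> B !=set0 -> 0 <= dist_sets A B.
Proof.
move=> [a Aa] [b Bb]; apply: lb_le_inf; last by move=> _ [x _ [y _ <-]].
by exists `|a - b|; exists a => //; exists b.
Qed.

(** The midpoint of [a] and [a'] stays in the convex set [A], hence at distance at least [D] from
    [b]; if [a] and [a'] were far apart, uniform convexity would bring it closer. For [D = 0] the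
    triangle inequality suffices. *)
Lemma uniformly_convex_near_dist (R : realType) (X : normedModType R)
    (A B : set X) (e : R) :
  uniformly_convex X -> convex_set A -> 0 <= dist_sets A B -> 0 < e ->
  exists2 d, 0 < d & forall a a' b, A a -> A a' -> B b ->
    `|a - b| < dist_sets A B + d -> `|a' - b| < dist_sets A B + d ->
    `|a - a'| < e.
Proof.
move=> [delta [delta01 delta_lt ucX]] cvA; set D := dist_sets A B => D0 e0.
have [D_eq|D_neq] := eqVneq D 0.
  exists (e / 2); first by rewrite divr_gt0.
  move=> a a' b _ _ _; rewrite D_eq add0r => ab a'b.
  by rewrite (le_lt_trans (ler_distD b _ _))// (distrC b) (splitr e) ltrD.
have D_gt0 : 0 < D by rewrite lt_def D_neq.
(* Capping at [D] keeps the arguments of [delta] within its domain. *)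
pose r := Num.min e D.
have r0 : 0 < r by rewrite lt_min e0.
have rD : r <= D by rewrite ge_min lexx orbT.
have re : r <= e by rewrite ge_min lexx.
have in02 (t : R) : 0 < t <= 1 -> t \in `]0, 2].
  by move=> t01; rewrite in_itv/=; lra.
(* The radius used below is [K = (1 + c) * D <= 2 * D], so [c < delta (r / K)], while
   [(1 - c) * K = D - c^2 * D] does not exceed [D]. Comparison with [delta (r / (8 * D)) >= 0] makes
   [c] positive. *)
pose c := delta (r / (4 * D)).
have q1 : 0 < r / (4 * D) <= 1.
  by rewrite divr_gt0 ?mulr_gt0//= ler_pdivrMr ?mulr_gt0//; lra.
have q2 : 0 < r / (8 * D) <= 1.
  by rewrite divr_gt0 ?mulr_gt0//= ler_pdivrMr ?mulr_gt0//; lra.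
have c0 : 0 < c.
  have /andP[h _] := delta01 _ (in02 _ q2).
  apply: le_lt_trans h _; apply: delta_lt; rewrite ?in02//.
  by rewrite ltr_pM2l// ltf_pV2 ?posrE ?mulr_gt0//; lra.
have /andP[_ c1] := delta01 _ (in02 _ q1); rewrite -/c in c1.
exists (c * D); first exact: mulr_gt0.
move=> a a' b Aa Aa' Bb ab a'b.
rewrite ltNge; apply/negP => eaa'.
pose K := D + c * D.
have cD : c * D <= D by rewrite ler_piMl.
have cD0 : 0 < c * D by exact: mulr_gt0.
have K0 : 0 < K by rewrite /K; lra.
have := ucX a a' b K r K0 _ (ltW ab) (ltW a'b) (le_trans re eaa').
have rK : 0 < r <= 2 * K.
  by rewrite r0/= /K; lra.
move=> /(_ rK).
have q3 : 0 < r / K <= 1 by rewrite divr_gt0//= ler_pdivrMr// /K; lra.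
have c_lt : c < delta (r / K).
  apply: delta_lt; rewrite ?in02//.
  by rewrite ltr_pM2l// ltf_pV2 ?posrE ?mulr_gt0// /K; lra.
have : D <= `|2^-1 *: (a + a') - b|.
  apply: dist_sets_le => //.
  have h0 : (0 : R) <= 2^-1 by rewrite invr_ge0.
  have h1 : (2^-1 : R) <= 1 by rewrite invf_le1// ler1n.
  have := cvA a a' (Itv01 h0 h1); rewrite !inE => /(_ Aa Aa').
  congr (A _); rewrite scalerDr; congr (_ + _ *: _).
  by rewrite /= /unstable.onem {1}(splitr 1) div1r addrK.
move=> /le_trans h /h {}h.
have : (1 - delta (r / K)) * K < (1 - c) * K by rewrite ltr_pM2r// ltrD2l ltrN2.
move=> /(le_lt_trans h); rewrite /K.
have -> : (1 - c) * (D + c * D) = D - c * (c * D) by ring.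
by rewrite ltNge gerBl mulr_ge0// ltW.
Qed.

(** * Real sequences decreasing at a rate given by [phi] *)

Lemma strict_homo_nneg_le (R : realType) (phi : R -> R) :
  {in `[0, +oo[ &, {homo phi : s t / s < t}} ->
  forall s t, 0 <= s -> s <= t -> phi s <= phi t.
Proof.
move=> phi_lt s t s0; rewrite le_eqVlt => /predU1P[->//|st].
by rewrite ltW// phi_lt ?in_itv/= ?andbT// (le_trans s0)// ltW.
Qed.

(** The sequence is nonincreasing, and each step from a value at least [D + e] loses at least
    [phi (D + e) - phi D > 0]. Staying there forever would contradict the lower bound [D];
    continuity of [phi] does not enter. *)
Lemma phi_iteration_near (R : realType) (phi : R -> R) (D : R) (a : nat -> R) :
  {in `[0, +oo[ &, {homo phi : s t / s < t}} -> 0 <= D ->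
  (forall n, D <= a n) ->
  (forall n, a n.+1 <= a n - phi (a n) + phi D) ->
  forall e, 0 < e -> exists N, forall n, (N <= n)%N -> a n < D + e.
Proof.
move=> phi_lt D0 Da a_rec e e0.
have phi_le := strict_homo_nneg_le phi_lt.
have a_dec n k : a (n + k)%N <= a n.
  elim: k => [|k IH]; first by rewrite addn0.
  rewrite addnS; apply: le_trans IH; have := a_rec (n + k)%N.
  by have := phi_le _ _ D0 (Da (n + k)%N); lra.
pose c := phi (D + e) - phi D.
have De : 0 <= D + e by lra.
have c0 : 0 < c by rewrite subr_gt0 phi_lt ?in_itv/= ?andbT//; lra.
suff [N aN] : exists N, a N < D + e.
  by exists N => n /subnKC <-; exact: le_lt_trans (a_dec _ _) aN.
apply: contrapT => /forallNP h.
have far n : D + e <= a n by rewrite leNgt; exact/negP/h.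
have lin n : a n <= a 0%N - n%:R * c.
  elim: n => [|n IH]; first by rewrite mul0r subr0.
  have := a_rec n; have := phi_le _ _ De (far n).
  by rewrite -natr1 mulrDl mul1r /c in IH *; lra.
have := lin (Num.bound ((a 0%N - D) / c)).
have : 0 <= (a 0%N - D) / c by apply: divr_ge0; [rewrite subr_ge0|exact: ltW].
move=> /archi_boundP; rewrite ltr_pdivrMr//.
by have := Da (Num.bound ((a 0%N - D) / c)); lra.
Qed.

(** * Cyclic shifts of families of points *)

Lemma val_iter_ordS (m n : nat) (i : 'I_m) :
  iter n (@ordS m) i = ((i + n) %% m)%N :> nat.
Proof.
elim: n => [|n IH]; first by rewrite addn0 modn_small.
by rewrite iterS /= IH -addn1 modnDml addn1 addnS.
Qed.

Section Advance.
Context (R : realType) (X : normedModType R) (m : nat) (T : X -> X).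
Implicit Types (x y : 'I_m -> X) (v : X) (i j : 'I_m).

(* The family (T x_1, ..., T x_m), reindexed so that its i-th member is again
   in A_i. *)
Definition advance x i := T (x (ord_pred i)).

Lemma iter_advance n x i :
  iter n advance x i = iter n T (x (iter n (@ord_pred m) i)).
Proof. by elim: n i => // n IH i; rewrite iterS /advance IH -iterSr. Qed.

Lemma iter_advance_period x : iter m advance x = fun i => iter m T (x i).
Proof.
apply/funext => i; rewrite iter_advance; congr (iter m T (x _)).
have iterSK n : cancel (iter n (@ordS m)) (iter n (@ord_pred m)).
  by elim: n => // n IH j; rewrite iterSr [iter _ (@ordS m) j]iterS ordSK IH.
rewrite -[RHS](iterSK m); congr (iter m _ _).
by apply: ord_inj; rewrite val_iter_ordS modnDr modn_small.
Qed.

(* The cyclic distance from [i0] to [i], that is (i - i0) mod m. *)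
Definition offset i0 i : 'I_m := iter (m - i0)%N (@ordS m) i.

(* The family whose members, read from position [i0], are v, T v, T^2 v, ... *)
Definition spread i0 v i := iter (offset i0 i) T v.

Lemma offset_inj i0 : injective (offset i0).
Proof.
by rewrite /offset; elim: (m - i0)%N => // n IH i j /ordS_inj /IH.
Qed.

Lemma offset_ordS i0 i : offset i0 (ordS i) = ordS (offset i0 i).
Proof. by rewrite /offset -iterSr iterS. Qed.

Lemma val_offset i0 i : offset i0 i = ((i + (m - i0)) %% m)%N :> nat.
Proof. exact: val_iter_ordS. Qed.

Lemma val_offset_id i0 : offset i0 i0 = 0%N :> nat.
Proof. by rewrite val_offset subnKC 1?ltnW// modnn. Qed.

Lemma iter_offset i0 i : iter (offset i0 i) (@ordS m) i0 = i.
Proof.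
apply: ord_inj; rewrite val_iter_ordS val_offset modnDmr addnCA.
by rewrite subnKC 1?ltnW// modnDr modn_small.
Qed.

Lemma spread_id i0 v : spread i0 v i0 = v.
Proof. by rewrite /spread val_offset_id. Qed.

(** Away from [i0] the predecessor's offset is one less, so the extra [T] restores the same power;
    the offset wraps around only at [i0]. *)
Lemma advance_spread i0 v i : i != i0 -> advance (spread i0 v) i = spread i0 v i.
Proof.
move=> ii0; rewrite /advance /spread -iterS.
have oi : offset i0 i = ((offset i0 (ord_pred i)).+1 %% m)%N :> nat.
  by rewrite -{1}(ord_predK i) offset_ordS.
have [lt|ge] := ltnP (offset i0 (ord_pred i)).+1 m.
  by rewrite oi modn_small.
have eqm : (offset i0 (ord_pred i)).+1 = m by apply/eqP; rewrite eqn_leq ge ltn_ord.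
move: oi; rewrite eqm modnn => oi.
by case/eqP: ii0; apply: (@offset_inj i0); apply: ord_inj; rewrite /= oi val_offset_id.
Qed.

Lemma advance_spread_id i0 v : advance (spread i0 v) i0 = iter m T v.
Proof.
rewrite /advance /spread -iterS; congr (iter _ T v).
have : ordS (offset i0 (ord_pred i0)) = 0%N :> nat.
  by rewrite -offset_ordS ord_predK val_offset_id.
have := ltn_ord (offset i0 (ord_pred i0)) => /=.
rewrite leq_eqVlt => /predU1P[//|lt].
by rewrite modn_small.
Qed.

Lemma iter_advance_spread i0 k v :
  iter (m * k)%N advance (spread i0 v) = spread i0 (iter (m * k)%N T v).
Proof.
elim: k => [|k IH]; first by rewrite muln0.
rewrite mulnS !iterD IH iter_advance_period; apply/funext => i.
by rewrite /spread; move: (iter _ T v) => w; rewrite -!iterD addnC.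
Qed.

End Advance.

(** * Consequences of the contraction inequality *)

Section CyclicContraction.
Context (R : realType) (X : normedModType R) (p : \bar R) (phi : R -> R).
Context (m : nat) (A : 'I_m -> set X) (T : X -> X).
Hypothesis A_neq0 : forall i, A i !=set0.
Hypothesis p_ge1 : (1 <= p)%E.
Hypothesis phi_lt : {in `[0, +oo[ &, {homo phi : s t / s < t}}.
Hypothesis T_contr : cyclic_p_phi_contraction p phi A T.

Implicit Types (x y : 'I_m -> X) (v w : X) (i j : 'I_m).
Local Notation D := (dp_sets p A).
Local Notation selection x := (forall i, A i (x i)).

Lemma dp_sets_ge0 : 0 <= D. Proof. exact: lp_comb_ge0. Qed.

Lemma dp_sets_le x y : selection x -> selection y -> D <= dp_points p x y.
Proof.
move=> Ax Ay; apply: lp_comb_le => // i.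
by rewrite dist_sets_ge0//= dist_sets_le.
Qed.

Lemma selection_advance x : selection x -> selection (advance T x).
Proof.
move=> Ax i; rewrite -[i in A i]ord_predK; apply: (proj1 T_contr).
by exists (x (ord_pred i)).
Qed.

Lemma selection_iter_advance n x : selection x -> selection (iter n (advance T) x).
Proof. by move=> Ax; elim: n => // n IH; exact: selection_advance. Qed.

(** The families [T \o x] and [T \o y] are shifted by one index, and [dp_points] is invariant under
    a cyclic relabelling. *)
Lemma dp_advance x y : selection x -> selection y ->
  dp_points p (advance T x) (advance T y)
    <= dp_points p x y - phi (dp_points p x y) + phi D.
Proof.
move=> Ax Ay; apply: le_trans (proj2 T_contr x y Ax Ay).
rewrite /dp_points -[leRHS](lp_comb_reindex _ _ (can_inj (@ord_predK m))).
apply: lp_comb_le => // i; rewrite normr_ge0 /=.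
by rewrite /advance ord_predK ordSK.
Qed.

Lemma dp_iter_advance n x y : selection x -> selection y ->
  dp_points p (iter n (advance T) x) (iter n (advance T) y) <= dp_points p x y.
Proof.
move=> Ax Ay; elim: n => // n IH; apply: le_trans IH.
have Ax' := selection_iter_advance n Ax; have Ay' := selection_iter_advance n Ay.
have := dp_advance Ax' Ay'.
have := strict_homo_nneg_le phi_lt dp_sets_ge0 (dp_sets_le Ax' Ay').
by rewrite !iterS; lra.
Qed.

Lemma dp_iter_advance_near x y e : selection x -> selection y -> 0 < e ->
  exists N, forall n, (N <= n)%N ->
    dp_points p (iter n (advance T) x) (iter n (advance T) y) < D + e.
Proof.
move=> Ax Ay.
have Ax' n := selection_iter_advance n Ax.
have Ay' n := selection_iter_advance n Ay.
apply: (phi_iteration_near phi_lt dp_sets_ge0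
  (a := fun n => dp_points p (iter n (advance T) x) (iter n (advance T) y))).
  by move=> n; exact: (dp_sets_le (Ax' n) (Ay' n)).
by move=> n; exact: (dp_advance (Ax' n) (Ay' n)).
Qed.

(* The hypothesis on i is only needed for p = +oo, where d_p controls nothing
   but the largest distance. *)
Lemma dp_points_near i e :
  dist_sets (A i) (A (ordS i)) = dp_sets +oo%E A -> 0 < e ->
  exists2 d, 0 < d & forall x y, selection x -> selection y ->
    dp_points p x y < D + d ->
    `|x i - y (ordS i)| < dist_sets (A i) (A (ordS i)) + e.
Proof.
move=> Ai e0; pose c j := dist_sets (A j) (A (ordS j)).
have c0 j : 0 <= c j by exact: dist_sets_ge0.
(* This is the growth of [D] when the [i]-th set distance is raised by [e]. A pair violating the
   conclusion dominates all the raised distances. *)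
exists (lp_comb p (fun j => c j + e *+ (j == i)) - D).
  by rewrite subr_gt0; exact: lp_comb_lt.
move=> x y Ax Ay; rewrite addrC subrK; apply: contraTT; rewrite -!leNgt => far.
apply: lp_comb_le => // j; rewrite addr_ge0 ?mulrn_wge0 ?(ltW e0)//=.
by have [->|_] := eqVneq j i; rewrite ?mulr1n// mulr0n addr0; exact: dist_sets_le.
Qed.

(** Both [x i] and [x' i] are nearly closest to the common point [y (ordS i)]. *)
Lemma dp_points_near_eq i e : uniformly_convex X -> convex_set (A i) ->
  dist_sets (A i) (A (ordS i)) = dp_sets +oo%E A -> 0 < e ->
  exists2 d, 0 < d & forall x x' y, selection x -> selection x' -> selection y ->
    dp_points p x y < D + d -> dp_points p x' y < D + d -> `|x i - x' i| < e.
Proof.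
move=> ucX cvA Ai e0.
have [c c0 near_c] :=
  uniformly_convex_near_dist ucX cvA (dist_sets_ge0 (A_neq0 i) (A_neq0 (ordS i))) e0.
have [d d_gt0 near_d] := dp_points_near Ai c0.
exists d => // x x' y Ax Ax' Ay xy x'y.
by apply: (near_c _ _ (y (ordS i))) => //; exact: near_d.
Qed.

Lemma dp_points_change_l x x' y i : (forall j, j != i -> x j = x' j) ->
  dp_points p x y <= dp_points p x' y + `|x i - x' i|.
Proof.
move=> xx'; apply: (lp_comb_perturb (i := i)) => // [j ji|].
  by rewrite xx'.
by rewrite [leRHS]addrC ler_distD.
Qed.

Lemma dp_points_change_r x y y' i : (forall j, j != i -> y j = y' j) ->
  dp_points p x y <= dp_points p x y' + `|y i - y' i|.
Proof.
(* The point [y i] enters only the distance indexed by the predecessor of [i]. *)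
move=> yy'; apply: (lp_comb_perturb (i := ord_pred i)) => // [j ji|].
  by rewrite yy'//; apply: contraNneq ji => <-; rewrite ordSK.
by rewrite ord_predK (distrC (y i)) ler_distD.
Qed.

Lemma selection_spread i0 v : A i0 v -> selection (spread T i0 v).
Proof.
move=> Av i; rewrite -[i in A i](iter_offset i0) /spread.
elim: (nat_of_ord _) => // n IH; rewrite !iterS.
by apply: (proj1 T_contr); exists (iter n T v).
Qed.

Lemma dp_points_spread i0 v w :
  dp_points p (spread T i0 v) (spread T i0 w) =
  dp_points p (fun i : 'I_m => iter i T v) (fun i : 'I_m => iter i T w).
Proof.
rewrite /dp_points -[RHS](lp_comb_reindex _ _ (@offset_inj m i0)).
by congr lp_comb; apply/funext => i; rewrite /= /spread offset_ordS.
Qed.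

(** Advancing alters each family only at [i0], so [dp_points] drops by at most the right-hand side,
    while the contraction forces a drop of at least the left-hand side. *)
Lemma phi_dp_points_spread i0 v w : A i0 v -> A i0 w ->
  phi (dp_points p (spread T i0 v) (spread T i0 w)) - phi D
    <= `|v - iter m T v| + `|w - iter m T w|.
Proof.
move=> /selection_spread Av /selection_spread Aw.
have := dp_advance Av Aw.
have := @dp_points_change_l (spread T i0 v) (advance T (spread T i0 v))
  (spread T i0 w) i0.
have := @dp_points_change_r (advance T (spread T i0 v)) (spread T i0 w)
  (advance T (spread T i0 w)) i0.
rewrite !advance_spread_id !spread_id => h1 h2.
have {}h1 := h1 (fun j ji => esym (advance_spread T w ji)).
have {}h2 := h2 (fun j ji => esym (advance_spread T v ji)).
lra.
Qed.

End CyclicContraction.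

(** * Convergence of the orbit and the fixed point *)

Lemma cauchy_dist_cvg (R : realType) (X : completeNormedModType R) (u : nat -> X) :
  (forall e, 0 < e -> exists N, forall k l, (N <= k)%N -> (N <= l)%N ->
     `|u k - u l| < e) ->
  cvgn u.
Proof.
move=> h; apply/cauchy_cvgP/cauchy_ballP => e e0; near_simpl.
have [N hN] := h e e0.
exists ([set k | (N <= k)%N], [set k | (N <= k)%N]); first by split; exists N.
by move=> [k l] /= [Nk Nl]; rewrite -ball_normE; exact: hN.
Qed.

Theorem theorem3p7 (R : realType) (X : completeNormedModType R)
    (hX : uniformly_convex X)
    (m : nat) (hm : (0 < m)%N) (A : 'I_m -> set X)
    (hA : forall i, A i !=set0)
    (p : \bar R) (hp : (1 <= p)%E)
    (phi : R -> R) (hphi0 : forall t, 0 <= t -> 0 <= phi t)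
    (hphi : {in `[0, +oo[ &, {homo phi : s t / s < t}})
    (T : X -> X)
    (hTU : set_fun (\bigcup_i A i) (\bigcup_i A i) T)
    (hT : cyclic_p_phi_contraction p phi A T)
    (x0 : X) (hx0 : A (Ordinal hm) x0)
    (i0 : 'I_m) (hcl : closed (A i0)) (hcvx : convex_set (A i0))
    (hd : dist_sets (A i0) (A (ordS i0)) = dp_sets +oo%E A) :
  exists! x : X,
    [/\ A i0 x,
        iter (m * n + i0) T x0 @[n --> \oo] --> x,
        iter m T x = x &
        dp_points p (fun i : 'I_m => iter i T x) (fun i : 'I_m => iter i T x)
          = dp_sets p A].
Proof.
(* Indices start at 0, so [i0] here is the usual position minus one. *)
pose w k := iter (m * k + i0) T x0.
pose D := dp_sets p A.
pose G v v' := dp_points p (spread T i0 v) (spread T i0 v').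
have spreadA v : A i0 v -> forall i, A i (spread T i0 v i).
  exact: (selection_spread hT).
have wS k : iter m T (w k) = w k.+1 by rewrite /w -iterD addnA -mulnS.
have wE k l : iter (m * k) T (w l) = w (k + l)%N.
  by rewrite /w -iterD addnA -mulnDr.
have wA k : A i0 (w k).
  have -> : i0 = iter (m * k + i0) (@ordS m) (Ordinal hm).
    by apply: ord_inj; rewrite val_iter_ordS add0n mulnC modnMDl modn_small.
  rewrite /w; elim: (_ + _)%N => // n IH; rewrite !iterS.
  by apply: (proj1 hT); exists (iter n T x0).
have DG v v' : A i0 v -> A i0 v' -> D <= G v v'.
  by move=> Av Av'; apply: dp_sets_le => //; exact: spreadA.
have near_eq := dp_points_near_eq hA hp hX hcvx hd.
(* The bound [N] depends on [k] and [l]; [G_lim] below is uniform in both indices. *)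
have G_near e k l : 0 < e -> exists N, forall n, (N <= n)%N ->
    G (w (n + k)%N) (w (n + l)%N) < D + e.
  move=> e0.
  have [N hN] := dp_iter_advance_near hA hp hphi hT
    (spreadA _ (wA k)) (spreadA _ (wA l)) e0.
  exists N => n Nn; have := hN (m * n)%N (leq_trans Nn (leq_pmull n hm)).
  by rewrite !iter_advance_spread !wE.
have w_asympt e : 0 < e -> exists N, forall n, (N <= n)%N ->
    `|w n - w n.+1| < e.
  move=> e0; have [d d0 hde] := near_eq _ e0.
  have [N1 h1] := G_near _ 0%N 0%N d0; have [N2 h2] := G_near _ 1%N 0%N d0.
  exists (maxn N1 N2) => n; rewrite geq_max => /andP[/h1 h01 /h2 h02].
  rewrite !addn0 in h01 h02; rewrite addn1 in h02.
  have := hde _ _ _ (spreadA _ (wA n)) (spreadA _ (wA n.+1)) (spreadA _ (wA n)).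
  by rewrite !spread_id; apply.
have G_lim e : 0 < e -> exists N, forall k l, (N <= k)%N -> (N <= l)%N ->
    G (w k) (w l) < D + e.
  move=> e0; have D0 : 0 <= D by exact: dp_sets_ge0.
  pose c := phi (D + e) - phi D.
  have c0 : 0 < c.
    by rewrite subr_gt0 hphi ?in_itv/= ?andbT ?ltrDl// addr_ge0// ltW.
  (* Two consecutive gaps below [c / 2] keep [phi (G (w k) (w l)) - phi D] below [c], which excludes
     [G (w k) (w l) >= D + e]. *)
  have [N hN] := w_asympt (c / 2) (divr_gt0 c0 (ltr0Sn _ 1)).
  exists N => k l /hN hk /hN hl; rewrite ltNge; apply/negP => far.
  have := phi_dp_points_spread hp hT (wA k) (wA l).
  have De : 0 <= D + e by rewrite addr_ge0// ltW.
  have := strict_homo_nneg_le hphi De far.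
  by rewrite !wS /c /G /D in hk hl *; lra.
have w_cauchy e : 0 < e -> exists N, forall k l, (N <= k)%N -> (N <= l)%N ->
    `|w k - w l| < e.
  move=> e0; have [d d0 hde] := near_eq _ e0.
  have [N hN] := G_lim _ d0.
  exists N => k l Nk Nl.
  have := hde _ _ _ (spreadA _ (wA k)) (spreadA _ (wA l)) (spreadA _ (wA k)).
  by rewrite !spread_id; apply; apply: hN.
have /cvg_ex[x wx] := cauchy_dist_cvg w_cauchy.
have Ax : A i0 x.
  by apply: closed_cvg wx => //; exact: nearW.
have w_near e : 0 < e -> exists N, forall n, (N <= n)%N -> `|x - w n| < e.
  move=> e0; have /cvgrPdist_lt/(_ e e0)[N _ hN] := wx.
  by exists N => n /hN.
have Tx : iter m T x = x.
  apply/eqP; rewrite -subr_eq0 -normr_le0; apply/ler_addgt0Pr => e e0.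
  rewrite add0r.
  have e20 : 0 < e / 2 by rewrite divr_gt0.
  have [d d0 hde] := near_eq _ e20.
  have d20 : 0 < d / 2 by rewrite divr_gt0.
  have [N1 h1] := G_lim _ d20; have [N2 h2] := w_near _ d20.
  have [N3 h3] := w_near _ e20.
  pose k := maxn (maxn N1 N2) N3.
  have [/andP[k1 k2] k3] : ((N1 <= k) && (N2 <= k) /\ (N3 <= k))%N.
    by rewrite /k !leq_max !leqnn !orbT.
  (* Replacing one entry by the limit costs less than [d / 2] in [dp_points]; after [m] advances
     that entry is [T^m x], next to [w k.+1], so no continuity of [T] is called upon. *)
  pose z i := if i == i0 then x else spread T i0 (w k) i.
  have Az i : A i (z i).
    by rewrite /z; case: eqP => [->//|_]; exact: spreadA.
  have Aw : forall i, A i (spread T i0 (w k) i) by exact: spreadA.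
  have zw : dp_points p z (spread T i0 (w k)) < D + d.
    apply: le_lt_trans (dp_points_change_l (x' := spread T i0 (w k)) (i := i0) hp _ _) _.
      by move=> j /negPf; rewrite /z => ->.
    rewrite /z eqxx spread_id (splitr d) addrA ltrD ?h2//.
    exact: h1.
  have Ez : dp_points p (iter m (advance T) z) (spread T i0 (w k.+1)) < D + d.
    have := dp_iter_advance hA hp hphi hT m Az Aw.
    have := iter_advance_spread T i0 1 (w k); rewrite muln1 wS => -> h.
    exact: le_lt_trans h zw.
  have Ew : dp_points p (spread T i0 (w k.+1)) (spread T i0 (w k.+1)) < D + d.
    have k1' := leqW k1.
    by apply: lt_trans (h1 _ _ k1' k1') _; rewrite ltrD2l; lra.
  have := hde _ _ _ (selection_iter_advance hT m Az) (spreadA _ (wA k.+1))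
    (spreadA _ (wA k.+1)) Ez Ew.
  rewrite iter_advance_period /z eqxx spread_id => Tw.
  have := h3 _ (leqW k3); have := ler_distD (w k.+1) (iter m T x) x.
  by rewrite (distrC (w _) x); lra.
exists x; split; last first.
  by move=> x' [_ wx' _ _]; apply: (cvg_unique _ wx wx').
split => //.
(* With both gaps zero, [phi (G x x) <= phi D], and strict monotonicity gives [G x x <= D]. *)
rewrite -(dp_points_spread p T i0); apply/eqP; rewrite eq_le DG// andbT.
have := phi_dp_points_spread hp hT Ax Ax.
rewrite Tx subrr normr0 addr0 subr_le0 leNgt => /negP h.
rewrite leNgt; apply/negP => lt; apply: h.
have D0 : 0 <= D by exact: dp_sets_ge0.
by rewrite hphi ?in_itv/= ?andbT// (le_trans D0)// ltW.
Qed.
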